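(* Let $(R,\mathfrak{m})$ be a Cohen-Macaulay (Noetherian) local ring of dimension $d\geq 2$, with $d\geq 3$ if $R$ is regular. Let $t\geq 2$ be an integer. If $\alpha_1,\dots,\alpha_d$ is a regular sequence contained in $\mathfrak{m}^t$, then $$(\alpha_1,\dots,\alpha_d):\mathfrak{m}^t\subseteq \mathfrak{m}^t.$$
   Context: For ideals $A,B$ of a commutative ring $R$, $A:B=\{r\in R : rB\subseteq A\}$. *)

(* Defs.v *)
From mathcomp Require Import all_boot all_algebra.
From mathcomp Require Import boolp classical_sets.

Set Implicit Arguments.
Unset Strict Implicit.
Unset Printing Implicit Defensive.

Import GRing.Theory.

Local Open Scope classical_set_scope.
Local Open Scope ring_scope.

(* Ideals are Prop-valued sets, and may be the whole ring; the closure
   predicates of ring_quotient concern boolean predicates, and its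
   idealr_closed covers proper ideals only. *)
Definition is_ideal (R : comNzRingType) (I : set R) : Prop :=
  [/\ I 0, forall x y, I x -> I y -> I (x + y) & forall a x, I x -> I (a * x)].

Definition ideal_gen (R : comNzRingType) (A : set R) : set R :=
  smallest (@is_ideal R) A.

Definition ideal_mul (R : comNzRingType) (I J : set R) : set R :=
  ideal_gen [set z | exists x y, [/\ I x, J y & z = x * y]].

Definition ideal_pow (R : comNzRingType) (I : set R) (n : nat) : set R :=
  iter n (ideal_mul I) setT.

Definition ideal_colon (R : comNzRingType) (A B : set R) : set R :=
  [set r | forall b, B b -> A (r * b)].

Definition is_prime (R : comNzRingType) (P : set R) : Prop :=
  [/\ is_ideal P, ~ P 1 & forall x y, P (x * y) -> P x \/ P y].

Definition is_maximal (R : comNzRingType) (M : set R) : Prop :=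
  [/\ is_ideal M, ~ M 1 &
      forall I, is_ideal I -> ~ I 1 -> M `<=` I -> I = M].

Definition is_local (R : comNzRingType) (m : set R) : Prop :=
  is_maximal m /\ forall M, is_maximal M -> M = m.

Definition is_noetherian (R : comNzRingType) : Prop :=
  forall I : set R, is_ideal I -> exists s : seq R, I = ideal_gen [set` s].

Definition has_prime_chain (R : comNzRingType) (n : nat) : Prop :=
  exists P : 'I_n.+1 -> set R,
    (forall i, is_prime (P i)) /\
    (forall i j : 'I_n.+1, (i < j)%N -> P i `<` P j).

Definition has_krull_dim (R : comNzRingType) (d : nat) : Prop :=
  has_prime_chain R d /\ forall n, has_prime_chain R n -> (n <= d)%N.

Definition is_regular_seq (R : comNzRingType) (s : seq R) : Prop :=
  (forall i, (i < size s)%N -> forall r,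
     ideal_gen [set` take i s] (s`_i * r) -> ideal_gen [set` take i s] r)
  /\ ideal_gen [set` s] <> setT.

Definition has_regular_seq_in (R : comNzRingType) (I : set R) (n : nat) : Prop :=
  exists s : n.-tuple R, is_regular_seq s /\ [set` s] `<=` I.

Definition has_depth (R : comNzRingType) (m : set R) (n : nat) : Prop :=
  has_regular_seq_in m n /\ forall k, has_regular_seq_in m k -> (k <= n)%N.

(* For a Noetherian local ring with maximal ideal m: depth equals dimension. *)
Definition is_cohen_macaulay (R : comNzRingType) (m : set R) : Prop :=
  exists n, has_depth m n /\ has_krull_dim R n.

(* For a Noetherian local ring with maximal ideal m: m is generated by dim R
   elements. *)
Definition is_regular_local (R : comNzRingType) (m : set R) : Prop :=
  exists n, has_krull_dim R n /\
    exists s : n.-tuple R, m = ideal_gen [set` s].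

(* Main.v *)
(* Put A = (alpha_1, ..., alpha_(d-2)) and call a, b the last two terms of the
   sequence. If f multiplies m^t into A + (a, b), write f w = b g(w) modulo
   A + (a); then g is linear on m^t modulo A + (a). For x, y in m and u in
   m^(t-1) we get x g(y u) - y g(x u) = a h(x, y) modulo A, and cancelling a in
   the Koszul relation z h(x, y) - y h(x, z) + x h(y, z) = 0 modulo A puts
   m h(x, y) inside A + (x, y). Hence h(x, y) is in m, for otherwise
   m = (x, y) + m^2, so m = (x, y) by Nakayama; if d = 2 this makes R regular,
   and if d >= 3 it contradicts the existence of a regular sequence of length 3
   in m. Exchanging factors one at a time gives
   a g(b) - b g(a) in A + a m^t, so b g(a), hence g(a), is in A + (a);
   cancelling a shows that g(b) lies in A + (b) + m^t = m^t. Finally f = g(b)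
   modulo A + (a), by cancelling b. *)
Require Import Defs.
From mathcomp Require Import all_boot all_algebra.
From mathcomp Require Import boolp classical_sets.
From mathcomp Require Import ring.

Set Implicit Arguments.
Unset Strict Implicit.
Unset Printing Implicit Defensive.

Local Open Scope classical_set_scope.
Local Open Scope ring_scope.

Import GRing.Theory.

(** * Ideals, generators and powers *)

Lemma ideal0 {R : comNzRingType} {I : set R} : is_ideal I -> I 0.
Proof. by case. Qed.

Lemma idealD {R : comNzRingType} {I : set R} {x y : R} :
  is_ideal I -> I x -> I y -> I (x + y).
Proof. by case=> _ + _; exact. Qed.

Lemma idealMl {R : comNzRingType} {I : set R} (a : R) {x : R} :
  is_ideal I -> I x -> I (a * x).
Proof. by case=> _ _; exact. Qed.

Lemma idealMr {R : comNzRingType} {I : set R} (a : R) {x : R} :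
  is_ideal I -> I x -> I (x * a).
Proof. by rewrite mulrC; exact: idealMl. Qed.

Lemma idealB {R : comNzRingType} {I : set R} {x y : R} :
  is_ideal I -> I x -> I y -> I (x - y).
Proof.
by move=> iI Ix Iy; rewrite -mulN1r; apply/(idealD iI) => //; exact: idealMl.
Qed.

Lemma is_ideal_gen {R : comNzRingType} (S : set R) : is_ideal (ideal_gen S).
Proof.
split=> [I [[]] //|x y Sx Sy I IP|a x Sx I IP].
  by apply: (idealD IP.1); [exact: Sx|exact: Sy].
by apply: (idealMl _ IP.1); exact: Sx.
Qed.

Lemma sub_ideal_gen {R : comNzRingType} (S : set R) : S `<=` ideal_gen S.
Proof. exact: sub_gen_smallest. Qed.

Lemma ideal_gen_sub {R : comNzRingType} (S I : set R) :
  is_ideal I -> S `<=` I -> ideal_gen S `<=` I.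
Proof. by move=> iI SI; exact: smallest_sub. Qed.

(** The set is [I + (a)], in a form where membership directly yields a coefficient of [a]. *)
Lemma is_ideal_add_principal {R : comNzRingType} (I : set R) (a : R) :
  is_ideal I -> is_ideal [set x | exists c, I (x - c * a)].
Proof.
move=> iI; split=> [|x y [c cP] [e eP]|r x [c cP]].
- by exists 0; rewrite mul0r subr0; exact: ideal0.
- by exists (c + e); rewrite mulrDl opprD addrACA; exact: idealD.
- by exists (r * c); rewrite -mulrA -mulrBr; exact: idealMl.
Qed.

Lemma ideal_gen_nil {R : comNzRingType} (x : R) :
  ideal_gen [set` [::]] x -> x = 0.
Proof.
apply: (@ideal_gen_sub _ _ [set 0]) => //.
split=> [//|_ _ -> ->|a _ ->] /=; [exact: addr0|exact: mulr0].
Qed.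

(** Iterated down to [ideal_gen_nil], this turns membership in a finitely generated ideal into an
    explicit linear combination. *)
Lemma ideal_gen_cons {R : comNzRingType} (a : R) (s : seq R) (x : R) :
  ideal_gen [set` a :: s] x <-> exists c, ideal_gen [set` s] (x - c * a).
Proof.
split.
  apply: (ideal_gen_sub (is_ideal_add_principal a (is_ideal_gen _))) => y /=.
  rewrite inE => /orP[/eqP ->|ys].
    by exists 1; rewrite mul1r subrr; exact: ideal0 (is_ideal_gen _).
  by exists 0; rewrite mul0r subr0; exact: sub_ideal_gen.
move=> [c xc]; have iG := is_ideal_gen [set` a :: s].
rewrite -(subrK (c * a) x); apply: (idealD iG).
  apply: (ideal_gen_sub iG) xc => y /= ys.
  by apply: sub_ideal_gen; rewrite /= inE ys orbT.
by apply: (idealMl _ iG); apply: sub_ideal_gen; rewrite /= mem_head.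
Qed.

Lemma ideal_gen_rcons {R : comNzRingType} (a : R) (s : seq R) (x : R) :
  ideal_gen [set` rcons s a] x <-> exists c, ideal_gen [set` s] (x - c * a).
Proof.
rewrite -ideal_gen_cons.
suff -> : [set` rcons s a] = [set` a :: s] by [].
by apply/seteqP; split=> y /=; rewrite mem_rcons.
Qed.

Lemma mem_ideal_mul {R : comNzRingType} (I J : set R) (x y : R) :
  I x -> J y -> ideal_mul I J (x * y).
Proof. by move=> Ix Jy; apply: sub_ideal_gen; exists x, y. Qed.

Lemma is_ideal_pow {R : comNzRingType} (I : set R) (n : nat) :
  is_ideal (ideal_pow I n).
Proof. by case: n => [//|n]; exact: is_ideal_gen. Qed.

Lemma ideal_pow_mul {R : comNzRingType} (I : set R) (n k : nat) (x y : R) :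
  ideal_pow I n x -> ideal_pow I k y -> ideal_pow I (n + k) (x * y).
Proof.
elim: n x => [|n IHn] x Ix Iy; first exact: idealMl (is_ideal_pow _ _) Iy.
have [i0 iD iM] := is_ideal_pow I (n.+1 + k).
apply: (@ideal_gen_sub _ _ [set z | ideal_pow I (n.+1 + k) (z * y)]) Ix.
  split=> [|z w|a z] /=; first by rewrite mul0r.
    by rewrite mulrDl; exact: iD.
  by rewrite -mulrA; exact: iM.
move=> _ [z [w [Iz Iw ->]]] /=; rewrite -mulrA.
by apply: mem_ideal_mul => //; exact: IHn.
Qed.

Lemma ideal_pow_sub {R : comNzRingType} (I : set R) (n : nat) :
  is_ideal I -> ideal_pow I n.+1 `<=` I.
Proof.
move=> iI; apply: ideal_gen_sub => // _ [x [y [Ix _ ->]]]; exact: idealMr.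
Qed.

Lemma ideal_pow_sub_sqr {R : comNzRingType} (I : set R) (n : nat) :
  is_ideal I -> ideal_pow I n.+2 `<=` ideal_mul I I.
Proof.
move=> iI; apply: (ideal_gen_sub (is_ideal_gen _)) => _ [x [y [Ix Iy ->]]].
by apply: mem_ideal_mul => //; apply: ideal_pow_sub Iy.
Qed.

(** * Maximal ideals, units and Nakayama's lemma *)

Lemma exists_maximal {R : comNzRingType} (I : set R) :
  is_ideal I -> ~ I 1 -> exists2 M, is_maximal M & I `<=` M.
Proof.
move=> iI nI1.
(* The empty set is admitted because Zorn's lemma also ranges over the empty
   chain. *)
pose P : set (set R) := [set X | X = set0 \/ [/\ is_ideal X, ~ X 1 & I `<=` X]].
have [F FP Ftot|M [MP Mmax]] := @Zorn_bigcup R P.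
  have [[X FX X0]|F0] := pselect (exists2 X, F X & X !=set0); last first.
    left; apply/seteqP; split=> // x [X FX Xx]; apply: F0.
    by exists X => //; exists x.
  have FI Y y : F Y -> Y y -> [/\ is_ideal Y, ~ Y 1 & I `<=` Y].
    by move=> /FP[->|].
  right; split; last 1 first.
  - move=> x Ix; exists X => //; case: X0 => y Xy.
    by have [_ _] := FI _ _ FX Xy; exact.
  - split=> [|x y [Y FY Yx] [Z FZ Zy]|a x [Y FY Yx]].
    + by case: X0 => y Xy; exists X => //; have [/ideal0] := FI _ _ FX Xy.
    + have [iY _ _] := FI _ _ FY Yx; have [iZ _ _] := FI _ _ FZ Zy.
      have [YZ|ZY] := Ftot _ _ FY FZ.
        by exists Z => //; apply: (idealD iZ) => //; exact: YZ.
      by exists Y => //; apply: (idealD iY) => //; exact: ZY.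
    + by exists Y => //; have [iY _ _] := FI _ _ FY Yx; exact: idealMl.
  - by move=> [Y FY Y1]; have [] := FI _ _ FY Y1.
case: MP => [M0|[iM nM1 IM]].
  exfalso; apply: (Mmax I); last by right; split.
  by rewrite M0; split=> // /(_ 0 (ideal0 iI)).
exists M => //; split=> // J iJ nJ1 MJ; apply/seteqP; split=> //.
apply: contrapT => nJM; apply: (Mmax J); first by split.
by right; split=> //; exact: subset_trans MJ.
Qed.

(** A non-unit [1 - x] would lie in some maximal ideal, hence in [m], and then so would [1]. *)
Lemma local_unit {R : comNzRingType} (m : set R) (x : R) :
  is_local m -> m x -> exists v, v * (1 - x) = 1.
Proof.
move=> [[im nm1 _] uniq_m] mx; apply: contrapT => nv.
have iz : is_ideal [set 0 : R].
  by split=> [//|_ _ -> ->|a _ ->] /=; [exact: addr0|exact: mulr0].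
have [|M maxM sM] := exists_maximal (is_ideal_add_principal (1 - x) iz).
  by move=> [c /subr0_eq c1]; apply: nv; exists c.
apply: nm1; rewrite -(subrK x 1); apply: (idealD im) => //.
by rewrite -(uniq_m _ maxM); apply: sM; exists 1; rewrite mul1r subrr.
Qed.

(** Generators are discarded one at a time. Modulo [N + (s)] the head [a] is congruent to [c * a]
    with [c] in [m]; inverting [1 - c] puts [a] in [N + (s)]. *)
Lemma nakayama {R : comNzRingType} (m N : set R) (s : seq R) :
  is_local m -> is_ideal N -> m = ideal_gen [set` s] ->
  (forall z, m z -> exists2 n, N n & ideal_mul m m (z - n)) -> m `<=` N.
Proof.
move=> locm iN ms mN; have [[im _ _] _] := locm.
(* The equality [m = (s)] is weakened to [m] inside [N + (s)], which survives the removal of a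
   generator. *)
have gens z : m z -> exists2 n, N n & ideal_gen [set` s] (z - n).
  by rewrite {1}ms => sz; exists 0; rewrite ?subr0 //; exact: ideal0.
have sm : [set` s] `<=` m by rewrite ms; exact: sub_ideal_gen.
move: s gens sm {ms} => s.
elim: s => [gens _ z /gens[n Nn /ideal_gen_nil /subr0_eq ->] //|a s IHs].
move=> gens sm; have iG := is_ideal_gen [set` s].
have [iG0 iGD iGM] := iG; have [iN0 iND iNM] := iN; have [im0 imD imM] := im.
have sqr z : ideal_mul m m z ->
    exists c n, [/\ m c, N n & ideal_gen [set` s] (z - c * a - n)].
  apply: (@ideal_gen_sub _ _ [set z | exists c n,
    [/\ m c, N n & ideal_gen [set` s] (z - c * a - n)]]).
    split=> [|u v [c [n [mc Nn Gu]]] [c' [n' [mc' Nn' Gv]]]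
             |r u [c [n [mc Nn Gu]]]].
    - by exists 0, 0; split=> //; rewrite mul0r !subr0.
    - exists (c + c'), (n + n'); split; [exact: imD|exact: iND|].
      have -> : u + v - (c + c') * a - (n + n') =
        (u - c * a - n) + (v - c' * a - n') by ring.
      exact: iGD.
    - exists (r * c), (r * n); split; [exact: imM|exact: iNM|].
      have -> : r * u - r * c * a - r * n = r * (u - c * a - n) by ring.
      exact: iGM.
  move=> _ [x [y [mx my ->]]].
  have [n Nn /ideal_gen_cons[c Gc]] := gens _ my.
  exists (x * c), (x * n); split; [exact: idealMr|exact: iNM|].
  have -> : x * y - x * c * a - x * n = x * (y - n - c * a) by ring.
  exact: iGM.
have ma : m a by apply: sm; rewrite /= mem_head.
have [n Nn /sqr[c [n' [mc Nn' Ga]]]] := mN _ ma.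
have [v v1] := local_unit locm mc.
have {}Ga : ideal_gen [set` s] (a - v * (n + n')).
  have -> : a - v * (n + n') = v * (a - n - c * a - n') + (1 - v * (1 - c)) * a.
    by ring.
  by rewrite v1 subrr mul0r addr0; exact: iGM.
apply: IHs => [z /gens[k Nk /ideal_gen_cons[e Ge]]|y ys]; last first.
  by apply: sm; rewrite /= inE ys orbT.
exists (k + e * (v * (n + n'))).
  by apply: (iND) => //; apply/iNM/iNM/iND.
have -> : z - (k + e * (v * (n + n'))) =
  (z - k - e * a) + e * (a - v * (n + n')) by ring.
by apply: (iGD) => //; exact: iGM.
Qed.

(** Otherwise [m + (h)] is proper, so it equals [m] and contains [h]. The element [r] inverts [h] in
    the residue field. *)
Lemma maximal_inv_mod {R : comNzRingType} (m : set R) (h : R) :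
  is_maximal m -> ~ m h -> exists r, m (1 - r * h).
Proof.
move=> [im _ max_m] nmh; apply: contrapT => nr; apply: nmh.
rewrite -(max_m [set x | exists c, m (x - c * h)]) => [|||x mx].
- by exists 1; rewrite mul1r subrr; exact: ideal0.
- exact: is_ideal_add_principal.
- by move=> [c mc]; apply: nr; exists c.
- by exists 0; rewrite mul0r subr0.
Qed.

(** * Regular sequences in a two-generated ideal *)

(* Cramer's rule shows that the determinant [a1 * b2 - a2 * b1] multiplies
   [(x, y)], hence [c3], into [(c1, c2)], so it lies in [(c1, c2)]; comparing
   coefficients then gives [1 = r * y - s * x]. *)
Lemma regular_seq3_not_two_generated {R : comNzRingType}
    (x y a1 b1 a2 b2 a3 b3 : R)
    (c1 := a1 * x + b1 * y) (c2 := a2 * x + b2 * y) (c3 := a3 * x + b3 * y) :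
  (forall r, c1 * r = 0 -> r = 0) ->
  (forall r p, c2 * r = p * c1 -> exists q, r = q * c1) ->
  (forall r p q, c3 * r = p * c1 + q * c2 ->
     exists p' q', r = p' * c1 + q' * c2) ->
  exists r s, 1 = r * y - s * x.
Proof.
move=> reg1 reg2 reg3.
have [|p [q pq]] := reg3 (a1 * b2 - a2 * b1) (a3 * b2 - b3 * a2)
  (b3 * a1 - a3 * b1).
  by rewrite /c1 /c2 /c3; ring.
have cancel1 u v : c1 * u = c1 * v -> u = v.
  by move=> uv; apply/subr0_eq/reg1; rewrite mulrBr uv subrr.
(* Cramer's rule gives [x * (a1 * b2 - a2 * b1) = b2 * c1 - b1 * c2]; substituting [p * c1 + q * c2]
   for the determinant makes [c2 * (x * q + b1)] a multiple of [c1]. The next step is the same with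
   [y]. *)
have [r rP] : exists r, x * q + b1 = r * c1.
  apply: (reg2 _ (b2 - x * p)).
  have -> : c2 * (x * q + b1) =
    (b2 - x * p) * c1 + (x * (p * c1 + q * c2) - (b2 * c1 - b1 * c2)) by ring.
  by rewrite -pq; have -> : x * (a1 * b2 - a2 * b1) - (b2 * c1 - b1 * c2) = 0;
    rewrite ?addr0 // /c1 /c2; ring.
have [s sP] : exists s, y * q - a1 = s * c1.
  apply: (reg2 _ (- a2 - y * p)).
  have -> : c2 * (y * q - a1) =
    (- a2 - y * p) * c1 + (y * (p * c1 + q * c2) - (a1 * c2 - a2 * c1)) by ring.
  by rewrite -pq; have -> : y * (a1 * b2 - a2 * b1) - (a1 * c2 - a2 * c1) = 0;
    rewrite ?addr0 // /c1 /c2; ring.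
exists r, s; apply: cancel1.
have -> : c1 * (r * y - s * x) = (r * c1) * y - (s * c1) * x by ring.
by rewrite -rP -sP /c1; ring.
Qed.

(** * The colon ideal modulo all but two terms of the sequence *)

(** Here [A] stands for the ideal of the terms before [a] and [b]. The third hypothesis says that no
    two elements of [m] generate it modulo its square; [A] lies in that square, so relations modulo
    [A] can be tested against it. *)
Lemma colon_sub_mod {R : comNzRingType} (m A : set R) (a b f : R) (t : nat) :
  is_maximal m -> is_ideal A -> A `<=` ideal_mul m m ->
  (forall x y, m x -> m y -> exists2 z, m z &
     ~ exists p q, ideal_mul m m (z - p * x - q * y)) ->
  (forall r, A (a * r) -> A r) ->
  (forall r, (exists c, A (b * r - c * a)) -> exists c, A (r - c * a)) ->
  ideal_pow m t.+1 a -> ideal_pow m t.+1 b ->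
  (forall w, ideal_pow m t.+1 w ->
     exists q, exists c, A (f * w - q * b - c * a)) ->
  exists e c, ideal_pow m t.+1 e /\ A (f - e - c * a).
Proof.
move=> max_m iA Asqr gen3 rega regb ta tb colon.
have [im _ _] := max_m; have [im0 imD imM] := im; have [iA0 iAD iAM] := iA.
pose I := [set x | exists c, A (x - c * a)].
have iI : is_ideal I by exact: is_ideal_add_principal.
have [iI0 iID iIM] := iI.
(* The membership hypothesis sits under the existential so that choice gives a total [g]; its values
   off [m^(t+1)] are irrelevant. *)
have {colon} /choice[g gP] :
    forall w, exists q, ideal_pow m t.+1 w -> I (f * w - q * b).
  move=> w; have [/colon[q qP]|nw] := pselect (ideal_pow m t.+1 w).
    by exists q.
  by exists 0.
have isP k := is_ideal_pow m k.
have g_lin v w p q : ideal_pow m t.+1 v -> ideal_pow m t.+1 w ->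
    I (g (p * v + q * w) - (p * g v + q * g w)).
  move=> tv tw; apply: (regb); rewrite -/(I _).
  have tvw : ideal_pow m t.+1 (p * v + q * w).
    by apply: (idealD (isP _)); exact: (idealMl _ (isP _)).
  have -> : b * (g (p * v + q * w) - (p * g v + q * g w)) =
    (p * (f * v - g v * b) + q * (f * w - g w * b)) -
    (f * (p * v + q * w) - g (p * v + q * w) * b) by ring.
  apply: (idealB iI); last exact: gP.
  by apply: (iID); apply: (iIM); exact: gP.
(* Both [b * x * g (y * u)] and [b * y * g (x * u)] are [f * x * y * u] modulo [I], and [b]
   cancels. *)
have swap0 x y u : ideal_pow m t.+1 (y * u) -> ideal_pow m t.+1 (x * u) ->
    I (x * g (y * u) - y * g (x * u)).
  move=> tyu txu; apply: (regb); rewrite -/(I _).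
  have -> : b * (x * g (y * u) - y * g (x * u)) =
    y * (f * (x * u) - g (x * u) * b) - x * (f * (y * u) - g (y * u) * b).
    by ring.
  by apply: (idealB iI); apply: (iIM); exact: gP.
have swap1 x y u : m x -> m y -> ideal_pow m t u ->
    exists2 h, m h & A (x * g (y * u) - y * g (x * u) - h * a).
  move=> mx my tu; have tM z : m z -> ideal_pow m t.+1 (z * u).
    by move=> mz; exact: mem_ideal_mul.
  have [h hP] := swap0 x y u (tM _ my) (tM _ mx).
  exists h => //; apply: contrapT => nmh.
  have [r mr] := maximal_inv_mod max_m nmh.
  have [z mz] := gen3 x y mx my; apply.
  have [h1 h1P] := swap0 x z u (tM _ mz) (tM _ mx).
  have [h2 h2P] := swap0 y z u (tM _ mz) (tM _ my).
  have Ah : A (z * h - y * h1 + x * h2).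
    apply: (rega); rewrite -[X in A X]opprK -mulN1r; apply: (iAM).
    have -> : - (a * (z * h - y * h1 + x * h2)) =
      z * (x * g (y * u) - y * g (x * u) - h * a) -
      y * (x * g (z * u) - z * g (x * u) - h1 * a) +
      x * (y * g (z * u) - z * g (y * u) - h2 * a) by ring.
    by apply: (iAD); [apply: (idealB iA)|]; exact: iAM.
  (* The coefficients solve the Koszul relation [Ah] for [z] modulo the square of [m], with [r] as
     inverse of [h]. *)
  exists (- (r * h2)), (r * h1).
  have -> : z - - (r * h2) * x - r * h1 * y =
    (1 - r * h) * z + r * (z * h - y * h1 + x * h2) by ring.
  apply: (idealD (is_ideal_gen _)); first exact: mem_ideal_mul.
  by apply: (idealMl _ (is_ideal_gen _)); exact: Asqr.
(* [J k] is [A + a * m^k], so [I] is [J 0]; multiplying by an element of [m^k] raises the level by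
   [k]. *)
pose J k := [set x | exists2 h, ideal_pow m k h & A (x - h * a)].
have iJ k : is_ideal (J k).
  split=> [|x y [h kh Ax] [h' kh' Ay]|r x [h kh Ax]].
  - by exists 0; [exact: ideal0|rewrite mul0r subr0].
  - by exists (h + h'); [exact: idealD|rewrite mulrDl opprD addrACA; exact: iAD].
  - by exists (r * h); [exact: idealMl|rewrite -mulrA -mulrBr; exact: iAM].
have JM k l x z : ideal_pow m k x -> J l z -> J (k + l)%N (x * z).
  move=> kx [h lh Az]; exists (x * h); first exact: ideal_pow_mul.
  by rewrite -mulrA -mulrBr; exact: iAM.
have JI k x z : ideal_pow m k x -> I z -> J k (x * z).
  move=> kx [c Az]; exists (x * c); first exact: idealMr.
  by rewrite -mulrA -mulrBr; exact: iAM.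
have pow1 x : m x -> ideal_pow m 1 x.
  by move=> mx; rewrite -(mulr1 x); exact: mem_ideal_mul.
(* Exchanging arguments from [m^k] is exact up to [J k]. The cofactor [u] keeps the arguments of [g]
   in [m^(t+1)]; the bound on [k] prevents truncated subtraction. *)
have swap k v w u : (k <= t.+1)%N -> ideal_pow m k v -> ideal_pow m k w ->
    ideal_pow m (t.+1 - k) u -> J k (v * g (w * u) - w * g (v * u)).
  elim: k v w u => [|k IHk] v w u kt kv kw ku.
    rewrite subn0 in ku; have uM z : ideal_pow m t.+1 (z * u).
      exact: (idealMl _ (isP _)).
    by have [h Ah] := swap0 v w u (uM _) (uM _); exists h.
  have tM z : ideal_pow m k.+1 z -> ideal_pow m t.+1 (z * u).
    by move=> kz; rewrite -(subnKC kt); exact: ideal_pow_mul.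
  (* The additivity error of [g] lies in [I], and the factor outside [g] puts
     it in [J k.+1]. *)
  have closed w' : ideal_pow m k.+1 w' -> is_ideal [set v |
      ideal_pow m k.+1 v /\ J k.+1 (v * g (w' * u) - w' * g (v * u))].
    move=> kw'; have lin x y p q : ideal_pow m k.+1 x -> ideal_pow m k.+1 y ->
        J k.+1 (x * g (w' * u) - w' * g (x * u)) ->
        J k.+1 (y * g (w' * u) - w' * g (y * u)) ->
        J k.+1 ((p * x + q * y) * g (w' * u) - w' * g ((p * x + q * y) * u)).
      move=> kx ky Jx Jy.
      have -> : (p * x + q * y) * g (w' * u) - w' * g ((p * x + q * y) * u) =
        (p * (x * g (w' * u) - w' * g (x * u)) +
         q * (y * g (w' * u) - w' * g (y * u))) -
        w' * (g (p * (x * u) + q * (y * u)) - (p * g (x * u) + q * g (y * u))).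
        rewrite (_ : (p * x + q * y) * u = p * (x * u) + q * (y * u)); last first.
          by ring.
        by ring.
      apply: (idealB (iJ _)).
        by apply: (idealD (iJ _)); exact: (idealMl _ (iJ _)).
      by apply: (JI) => //; apply: (g_lin); exact: tM.
    have J0 : J k.+1 (0 * g (w' * u) - w' * g (0 * u)).
      have k0 := ideal0 (isP k.+1).
      rewrite mul0r sub0r -mulrN; apply: (JI) => //.
      have := g_lin _ _ 0 0 (tM _ k0) (tM _ k0).
      rewrite !mul0r !addr0 subr0 -mulN1r; exact: iIM.
    split=> [|x y [kx Jx] [ky Jy]|p x [kx Jx]]; split=> //.
    - exact: (ideal0 (isP _)).
    - exact: (idealD (isP _)).
    - by have := lin x y 1 1 kx ky Jx Jy; rewrite !mul1r.
    - exact: (idealMl _ (isP _)).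
    - by have := lin x x p 0 kx kx Jx Jx; rewrite mul0r addr0.
  (* By [closed], applied in each argument in turn, it is enough to treat the products generating
     [m^(k+1)]. *)
  suff prod x v1 y w1 : m x -> m y -> ideal_pow m k v1 -> ideal_pow m k w1 ->
      J k.+1 (x * v1 * g (y * w1 * u) - y * w1 * g (x * v1 * u)).
    suff [] : [set v' |
      ideal_pow m k.+1 v' /\ J k.+1 (v' * g (w * u) - w * g (v' * u))] v by [].
    apply: (ideal_gen_sub (closed _ kw)) kv => _ [x [v1 [mx kv1 ->]]].
    have kxv : ideal_pow m k.+1 (x * v1) by exact: mem_ideal_mul.
    split=> //; rewrite -[X in J _ X]opprK -mulN1r opprB.
    apply: (idealMl _ (iJ _)).
    suff [] : [set w' | ideal_pow m k.+1 w' /\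
      J k.+1 (w' * g (x * v1 * u) - x * v1 * g (w' * u))] w by [].
    apply: (ideal_gen_sub (closed _ kxv)) kw => _ [y [w1 [my kw1 ->]]].
    by split; [exact: mem_ideal_mul|exact: prod].
  move=> mx my kv1 kw1.
  (* First [v1] and [w1] are exchanged with cofactor [y * u], gaining [k] by induction and one more
     from [x]; then [x] and [y] with cofactor [v1 * u], gaining one by [swap1] and [k] from [w1]. *)
  have -> : x * v1 * g (y * w1 * u) - y * w1 * g (x * v1 * u) =
    x * (v1 * g (w1 * (y * u)) - w1 * g (v1 * (y * u))) +
    w1 * (x * g (y * (v1 * u)) - y * g (x * (v1 * u))).
    rewrite (_ : y * w1 * u = w1 * (y * u)); last by ring.
    rewrite (_ : v1 * (y * u) = y * (v1 * u)); last by ring.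
    by rewrite -(mulrA x v1 u); ring.
  apply: (idealD (iJ _)).
    apply: (JM 1%N k); first exact: pow1.
    by apply: (IHk) => //; [exact: ltnW|rewrite subSn //; exact: mem_ideal_mul].
  rewrite -addn1; apply: (JM) => //.
  have tvu : ideal_pow m t (v1 * u).
    by rewrite -(subnKC (kt : (k <= t)%N)); exact: ideal_pow_mul.
  have [h mh Ah] := swap1 x y (v1 * u) mx my tvu.
  by exists h => //; exact: pow1.
have [h th Ah] : J t.+1 (a * g b - b * g a).
  have := swap t.+1 a b 1 (leqnn _) ta tb.
  by rewrite !mulr1 subnn; exact.
have [c Ac] : I (g a).
  apply: (regb); exists (g b - h).
  have -> : b * g a - (g b - h) * a = - 1 * (a * g b - b * g a - h * a) by ring.
  exact: iAM.
have [e Ae] : I (f - g b).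
  by apply: (regb); rewrite -/(I _) mulrBr [b * f]mulrC [b * g b]mulrC; exact: gP.
(* Modulo [A], [a * g b] is [b * g a + h * a] and [g a] is [c * a], so cancelling [a] leaves
   [g b = h + c * b], with [h] and [b] in [m^(t+1)]. *)
exists (h + c * b), e; split.
  by apply: (idealD (isP _)) => //; exact: (idealMl _ (isP _)).
have -> : f - (h + c * b) - e * a = (f - g b - e * a) + (g b - h - c * b) by ring.
apply: (iAD) => //; apply: (rega).
have -> : a * (g b - h - c * b) =
  (a * g b - b * g a - h * a) + b * (g a - c * a) by ring.
by apply: (iAD) => //; exact: iAM.
Qed.

(** * Excluding two generators of the maximal ideal *)

(** Otherwise [m = (x, y)] by Nakayama. Then [d = 2] would make [R] regular, while for [d >= 3] the
    first three terms of [alpha] give [1 = r * y - s * x], an element of [m]. *)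
Lemma local_not_two_generated_mod_sqr {R : comNzRingType} (m : set R) (d : nat)
    (alpha : d.-tuple R) (x y : R) :
  is_noetherian R -> is_local m -> has_krull_dim R d -> (2 <= d)%N ->
  (is_regular_local m -> (3 <= d)%N) ->
  is_regular_seq alpha -> [set` alpha] `<=` m -> m x -> m y ->
  exists2 z, m z & ~ exists p q, ideal_mul m m (z - p * x - q * y).
Proof.
move=> noeR locm dimR d2 regd [reg _] alpham mx my.
have [[im nm1 _] _] := locm.
apply: contrapT => no_z.
have sqr z : m z -> exists p q, ideal_mul m m (z - p * x - q * y).
  by move=> mz; apply: contrapT => nz; apply: no_z; exists z.
pose N := ideal_gen [set` [:: x; y]].
have iN : is_ideal N by exact: is_ideal_gen.
have mN : m `<=` N.
  have [s ms] := noeR _ im; apply: (nakayama locm iN ms) => z /sqr[p [q zP]].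
  exists (p * x + q * y); last by rewrite opprD addrA.
  by apply: (idealD iN); apply: (idealMl _ iN); apply: sub_ideal_gen;
    rewrite /= !inE eqxx ?orbT.
have mE : m = N.
  apply/seteqP; split=> //; apply: ideal_gen_sub => // z /=.
  by rewrite !inE => /orP[]/eqP ->.
have d3 : (3 <= d)%N.
  apply: contrapT => d_lt3; apply: (d_lt3); apply: regd.
  have d_eq2 : d = 2.
    by apply/eqP; rewrite eqn_leq d2 andbT leqNgt; apply/negP.
  exists 2; split; first by rewrite -d_eq2.
  by exists [tuple x; y]; exact: mE.
have comb i : (i < d)%N -> exists p q, alpha`_i = p * x + q * y.
  move=> id; have /mN : m alpha`_i.
    by apply: alpham; rewrite /= mem_nth // size_tuple.
  move=> /ideal_gen_cons[p /ideal_gen_cons[q /ideal_gen_nil]].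
  by rewrite -addrA -opprD => /subr0_eq; exists p, q.
have take1 : take 1 alpha = rcons [::] alpha`_0.
  by rewrite (take_nth 0) ?take0 // size_tuple ltnW // ltnW.
have take2 : take 2 alpha = rcons (rcons [::] alpha`_0) alpha`_1.
  by rewrite (take_nth 0) ?take1 // size_tuple ltnW.
have gen0 : ideal_gen [set` [::]] (0 : R) by exact: ideal0 (is_ideal_gen _).
have [] := comb 0; first by rewrite ltnW // ltnW.
move=> a1 [b1 e1].
have [] := comb 1; first by rewrite ltnW.
move=> a2 [b2 e2].
have [] := comb 2; first by [].
move=> a3 [b3 e3].
have [|||r [s rs]] :=
    @regular_seq3_not_two_generated _ x y a1 b1 a2 b2 a3 b3.
- move=> r; rewrite -e1 => r0; apply: ideal_gen_nil.
  have := reg 0; rewrite take0 size_tuple; apply; first by rewrite ltnW // ltnW.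
  by rewrite r0.
- move=> r p; rewrite -e1 -e2 => rp.
  have : ideal_gen [set` take 1 alpha] r.
    apply: (reg 1); first by rewrite size_tuple ltnW.
    by rewrite take1; apply/ideal_gen_rcons; exists p; rewrite rp subrr.
  rewrite take1 => /ideal_gen_rcons[q /ideal_gen_nil/subr0_eq ->].
  by exists q.
- move=> r p q; rewrite -e1 -e2 -e3 => rpq.
  have : ideal_gen [set` take 2 alpha] r.
    apply: (reg 2); first by rewrite size_tuple.
    rewrite take2; apply/ideal_gen_rcons; exists q.
    by apply/ideal_gen_rcons; exists p; rewrite rpq addrK subrr.
  rewrite take2 => /ideal_gen_rcons[q' /ideal_gen_rcons[p' /ideal_gen_nil]].
  by rewrite -addrA -opprD => /subr0_eq ->; exists p', q'; rewrite addrC.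
by apply: nm1; rewrite rs; apply: (idealB im); exact: (idealMl _ im).
Qed.

(** * The colon inclusion *)

Theorem theorem1p1 (R : comNzRingType) (m : set R) (d t : nat)
    (alpha : d.-tuple R) :
  is_noetherian R ->
  is_local m ->
  is_cohen_macaulay m ->
  has_krull_dim R d ->
  (2 <= d)%N ->
  (is_regular_local m -> (3 <= d)%N) ->
  (2 <= t)%N ->
  is_regular_seq alpha ->
  [set` alpha] `<=` ideal_pow m t ->
  ideal_colon (ideal_gen [set` alpha]) (ideal_pow m t) `<=` ideal_pow m t.
Proof.
move=> noeR locm _ dimR d2 regd t2 regalpha alphat f colon.
have [max_m _] := locm; have [im _ _] := max_m.
case: t t2 alphat colon => [|[|t]] // _ alphat colon.
have gen3 x y (mx : m x) (my : m y) := local_not_two_generated_mod_sqr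
  noeR locm dimR d2 regd regalpha
  (subset_trans alphat (ideal_pow_sub im)) mx my.
have [reg _] := regalpha.
case: d d2 alpha dimR regd regalpha alphat colon gen3 reg => [|[|d]] // _.
move=> alpha _ _ _ alphat colon gen3 reg.
have it := is_ideal_pow m t.+2.
pose s := take d alpha; pose a := alpha`_d; pose b := alpha`_d.+1.
have size_alpha := size_tuple alpha.
have takea : take d.+1 alpha = rcons s a.
  by rewrite (take_nth 0) // size_alpha ltnW.
have alphaE : alpha = rcons (rcons s a) b :> seq R.
  by rewrite -takea -take_nth ?size_alpha // take_oversize // size_alpha.
have alphaS : [set` alpha] = [set` rcons (rcons s a) b].
  by apply/seteqP; split=> x /=; rewrite memtE alphaE.
have st : ideal_gen [set` s] `<=` ideal_pow m t.+2.
  apply: (ideal_gen_sub it) => x /= sx; apply: alphat.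
  by rewrite /= memtE alphaE !(mem_rcons, inE) sx !orbT.
have ta : ideal_pow m t.+2 a.
  by apply: alphat; rewrite /= mem_nth // size_alpha ltnW.
have tb : ideal_pow m t.+2 b by apply: alphat; rewrite /= mem_nth // size_alpha.
(* The exponent is now [t.+2], which places the ideal of [s] in the square of [m]. *)
have [||||e [c [te Gf]]] :=
    @colon_sub_mod _ m (ideal_gen [set` s]) a b f t.+1 max_m (is_ideal_gen _)
      _ gen3 _ _ ta tb.
- exact: (subset_trans st (ideal_pow_sub_sqr im)).
- by move=> r; apply: (reg d); rewrite size_alpha ltnW.
- move=> r /ideal_gen_rcons; rewrite -takea => br.
  apply/ideal_gen_rcons; rewrite -takea.
  by move: br; apply: (reg d.+1); rewrite size_alpha.
- move=> w /colon; rewrite alphaS => /ideal_gen_rcons[q /ideal_gen_rcons qP].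
  by exists q.
(* Since [s] and [a] also lie in the power of [m], the congruence for [f] modulo [(s) + (a)] becomes
   membership. *)
have -> : f = (f - e - c * a) + (e + c * a) by ring.
apply: (idealD it); first exact: st.
by apply: (idealD it) => //; exact: (idealMl _ it).
Qed.
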